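(* Let $G=(V,E)$ be a finite graph, let $A$ be the transition (Markov) matrix of a random walk on the vertices of $G$, and fix a vertex $j\in V$. Let $Q$ be the matrix obtained from $A$ by removing the row and the column indexed by $j$. For each integer $n\ge 1$ let $P_n$ be the column vector indexed by the vertices $i\in V\setminus\{j\}$ with entries $(P_n)_i = P(\tau_{i,j}=n)$. Then for every integer $n\ge 1$, $$P_n = Q^{\,n-1}P_1 .$$
   Context: The random walk $(X_t)_{t\ge 0}$ is the time-homogeneous discrete-time Markov chain on $V$ with one-step transition probabilities $P(X_{t+1}=k\mid X_t=i)=A_{ik}$. For vertices $i\neq j$, the hitting time $\tau_{i,j}=\inf\{t : X_t=j\}$ is the first time that the walk started at $X_0=i$ is at $j$ (with $\tau_{i,j}=\infty$ if $j$ is never reached). The rows and columns of $Q$ and the entries of $P_n$ use the same (arbitrary) numbering of $V\setminus\{j\}$. *)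

(* Defs.v *)
From HB Require Import structures.
From mathcomp Require Import all_boot all_order all_algebra.
From mathcomp Require Import all_classical all_reals all_analysis.

Set Implicit Arguments.
Unset Strict Implicit.
Unset Printing Implicit Defensive.

Import Order.TTheory GRing.Theory Num.Theory.
Local Open Scope classical_set_scope.
Local Open Scope ring_scope.

(* [E] is the adjacency relation of the graph; loops (the walk may stay put) and
   one-way edges are permitted, and an undirected graph is a symmetric [E]. *)
Record transition_matrix_on (R : realType) (V : finType) (E : rel V)
    (A : V -> V -> R) : Prop := TransitionMatrixOn {
  transition_ge0 : forall i k, 0 <= A i k ;
  transition_sum1 : forall i, \sum_(k : V) A i k = 1 ;
  transition_edge : forall i k, A i k != 0 -> E i k
}.

(* P(B | C); only meaningful when [P C] is nonzero. *)
Definition cond_prob (R : realType) (d : measure_display)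
    (T : measurableType d) (P : probability T R) (B C : set T) : R :=
  fine (P (B `&` C)) / fine (P C).

(* The vertex set carries its discrete sigma-algebra, whence the form of
   [walk_measurable]. *)
Record random_walk_from (R : realType) (V : finType) (A : V -> V -> R) (i : V)
    (d : measure_display) (T : measurableType d) (P : probability T R)
    (X : nat -> T -> V) : Prop := RandomWalkFrom {
  walk_measurable : forall (t : nat) (B : set V), measurable (X t @^-1` B) ;
  walk_start : P [set w | X 0%N w = i] = 1%E ;
  walk_markov : forall (t : nat) (x : nat -> V) (k : V),
    P [set w | forall s, (s <= t)%N -> X s w = x s] != 0%E ->
    cond_prob P [set w | X t.+1 w = k]
                [set w | forall s, (s <= t)%N -> X s w = x s]
    = cond_prob P [set w | X t.+1 w = k] [set w | X t w = x t] ;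
  walk_transition : forall (t : nat) (l k : V),
    P [set w | X t w = l] != 0%E ->
    cond_prob P [set w | X t.+1 w = k] [set w | X t w = l] = A l k
}.

(* inf {t | X_t = j}, equal to +oo when [j] is never reached. *)
Definition hitting_time (R : realType) (V : finType) (T : Type)
    (X : nat -> T -> V) (j : V) (w : T) : \bar R :=
  ereal_inf [set (t%:R)%:E | t in [set t : nat | X t w = j]].

(* [f] numbers the vertices other than [j]. *)
Definition deleted_matrix (R : realType) (V : finType) (A : V -> V -> R) (j : V)
    (m : nat) (f : 'I_m -> {v : V | v != j}) : 'M[R]_m :=
  \matrix_(a < m, b < m) A (sval (f a)) (sval (f b)).

(* The walk started at [i] is [X i], living on its own probability space
   [(T i, P i)]; entry [a] is P(tau_{i,j} = n) for [i] numbered [a]. *)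
Definition hitting_vector (R : realType) (V : finType)
    (d : V -> measure_display) (T : forall i : V, measurableType (d i))
    (P : forall i : V, probability (T i) R) (X : forall i : V, nat -> T i -> V)
    (j : V) (m : nat) (f : 'I_m -> {v : V | v != j}) (n : nat) : 'cV[R]_m :=
  \col_(a < m) let i := sval (f a) in
    fine (P i [set w | hitting_time R (X i) j w = (n%:R)%:E]).

(* Main.v *)
(* Let S_n(i, k) be the probability that the walk started at i is
   at k at time n and avoids j before.  The Markov property gives
   S_(n+1)(i, k) = sum_(l <> j) S_n(i, l) A(l, k) for every k, including k = j.
   Hence S_n = Q^n off j, and taking k = j in the last step yields
   P_(n+1) = Q^n (A(., j)) and in particular P_1 = A(., j). *)
Require Import Defs.
From HB Require Import structures.
From mathcomp Require Import all_boot all_order all_algebra.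
From mathcomp Require Import all_classical all_reals all_analysis.
Import Order.TTheory GRing.Theory Num.Theory.
Local Open Scope ring_scope.
Local Open Scope classical_set_scope.

(** Allowing a set at each time covers both prescribed paths (singletons) and taboo events, so one
    Markov step can pass from the former to the latter. *)
Definition cylinder {V T : Type} (X : nat -> T -> V) (B : nat -> set V)
    (t : nat) : set T :=
  [set w | forall s, (s <= t)%N -> B s (X s w)].

(** Used with [cylinder] up to time [n], this gives the event behind S_n(i, k); for [k = j] it is a
    first visit to [j] at time [n]. *)
Definition taboo {V : Type} (j k : V) (n : nat) : nat -> set V :=
  fun s => [set y | if (s < n)%N then y <> j else y = k].

Lemma hitting_time_taboo (R : realType) (V : finType) (T : Type)
    (X : nat -> T -> V) (j : V) (n : nat) :
  [set w | hitting_time R X j w = (n%:R)%:E] = cylinder X (taboo j j n) n.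
Proof.
apply/seteqP; split => w /=; rewrite /hitting_time.
- move=> hn.
  have lb t : X t w = j -> (n <= t)%N.
    move=> ht; rewrite -(ler_nat R) -lee_fin -hn.
    by apply: ereal_inf_lbound; exists t.
  (* The infimum is attained: being below n + 1, it leaves a visit at some t <= n, and [lb] forces t
     = n. *)
  have hit : X n w = j.
    have : (ereal_inf [set (t%:R : R)%:E | t in [set t | X t w = j]]
             < (n.+1%:R)%:E)%E by rewrite hn lte_fin ltr_nat.
    move=> /ereal_inf_lt [_ [t /= ht <-]].
    rewrite lte_fin ltr_nat ltnS => tn.
    by rewrite (_ : n = t) //; apply/eqP; rewrite eqn_leq tn lb.
  move=> s sn; rewrite /taboo /=; case: ltnP => [ltsn|lesn].
    by move=> /lb; rewrite leqNgt ltsn.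
  by rewrite (_ : s = n) //; apply/eqP; rewrite eqn_leq sn.
- move=> hw; apply/eqP; rewrite eq_le; apply/andP; split.
    apply: ereal_inf_lbound; exists n => //=.
    by have := hw n (leqnn n); rewrite /taboo /= ltnn.
  apply: le_ereal_inf_tmp => _ [t /= ht <-].
  rewrite lee_fin ler_nat leqNgt; apply/negP => tn.
  by have := hw t (ltnW tn); rewrite /taboo /= tn; apply.
Qed.

Lemma measurable_cylinder (V : finType) (d : measure_display)
    (T : measurableType d) (X : nat -> T -> V) (B : nat -> set V) (t : nat)
    (mX : forall s (C : set V), measurable (X s @^-1` C)) :
  measurable (cylinder X B t).
Proof.
rewrite (_ : cylinder X B t = \bigcap_(s in [set s | (s <= t)%N]) X s @^-1` B s).
  by apply: bigcap_measurable => [|s _]; [exists 0%N|exact: mX].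
by apply/seteqP; split.
Qed.

Lemma prob_partition {R : realType} {V : finType} {d : measure_display}
    {T : measurableType d} {P : probability T R} (Y : T -> V) {C : set T}
    (mY : forall B : set V, measurable (Y @^-1` B)) (mC : measurable C) :
  fine (P C) = \sum_(v : V) fine (P (C `&` [set w | Y w = v])).
Proof.
have mCv v : measurable (C `&` [set w | Y w = v]).
  by apply: measurableI => //; exact: mY [set v].
rewrite {1}(_ : C = \bigcup_(v in [set` index_enum V])
    (C `&` [set w | Y w = v])); last first.
  apply/seteqP; split => w /=; last by case=> v _ [].
  by move=> Cw; exists (Y w) => //=; rewrite mem_index_enum.
rewrite measure_fin_bigcup //; last by move=> u v _ _ [w [[_ <-] [_ <-]]].
rewrite -fsbig_seq ?index_enum_uniq // -sum_fine //.
by move=> v _; exact: fin_num_measure.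
Qed.

Section RandomWalk.
Context {R : realType} {V : finType} {A : V -> V -> R} {i : V}
  {d : measure_display} {T : measurableType d} {P : probability T R}
  {X : nat -> T -> V} (hX : random_walk_from A i P X).

Let mX : forall t (B : set V), measurable (X t @^-1` B).
Proof. exact: walk_measurable hX. Qed.

Let mcyl B t : measurable (cylinder X B t).
Proof. exact: measurable_cylinder. Qed.

Lemma walk_path_step (t : nat) (x : nat -> V) (k : V) :
  fine (P (cylinder X (fun s => [set x s]) t `&` [set w | X t.+1 w = k])) =
  fine (P (cylinder X (fun s => [set x s]) t)) * A (x t) k.
Proof.
set C := cylinder _ _ _.
have mC : measurable C by exact: mcyl.
have mk s v : measurable [set w | X s w = v] by exact: (mX s [set v]).
(* On a null path the conditional probabilities carry no information, but both sides vanish by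
   monotonicity. *)
have [P0|PN0] := eqVneq (P C) 0%E.
  rewrite P0 mul0r (_ : P (_ `&` _) = 0%E) //.
  by apply: subset_measure0 P0; [exact: measurableI|exact: mC|exact: subIsetl].
have PtN0 : P [set w | X t w = x t] != 0%E.
  by apply: contra_neq PN0; apply: subset_measure0 => // w; exact.
have := walk_markov hX k PN0; rewrite (walk_transition hX _ PtN0) /cond_prob.
rewrite -/(cylinder X (fun s => [set x s]) t) -/C => <-.
rewrite mulrC divfK 1?setIC //.
by rewrite fine_eq0 //; exact: fin_num_measure.
Qed.

(** The Markov property for events of the past: only the present has to be pinned, because the
    transition probability depends on it alone. *)
Lemma walk_cylinder_step (t : nat) (B : nat -> set V) (l k : V) :
  B t `<=` [set l] ->
  fine (P (cylinder X B t `&` [set w | X t.+1 w = k])) =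
  fine (P (cylinder X B t)) * A l k.
Proof.
move=> Btl.
(* The hypothesis speaks of full paths only: fix x on [u, t] and, by induction
   on u, sum over the value of X_u to free one more coordinate. *)
suff step u : (u <= t)%N -> forall (B : nat -> set V) (x : nat -> V),
    (forall s, (u <= s <= t)%N -> B s `<=` [set x s]) ->
    fine (P (cylinder X B t `&` [set w | X t.+1 w = k])) =
    fine (P (cylinder X B t)) * A (x t) k.
  apply: (step t _ B (fun=> l)) => // s.
  by rewrite -eqn_leq => /eqP <-.
elim: u => [_|u IHu ut] {Btl} {}B x Bx.
  (* With every coordinate confined to a point, the cylinder is a single path event or empty. *)
  have [Bxt|/existsNP[s /not_implyP[st Bsx]]] :=
      pselect (forall s, (s <= t)%N -> B s (x s)).
    rewrite (_ : cylinder X B t = cylinder X (fun s => [set x s]) t).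
      exact: walk_path_step.
    apply/seteqP; split=> w hw s st; first by apply: Bx => //; exact: hw.
    by rewrite (hw s st); exact: Bxt.
  rewrite (_ : cylinder X B t = set0) ?set0I ?measure0 ?mul0r //.
  apply/seteqP; split=> // w hw; apply: Bsx.
  have <- : X s w = x s by apply: Bx => //; exact: hw.
  exact: hw.
have mk : measurable [set w | X t.+1 w = k] by exact: (mX _ [set k]).
rewrite (prob_partition (X u)); [|by []|exact: measurableI].
rewrite [in RHS](prob_partition (X u)) //.
rewrite big_distrl /=; apply: eq_bigr => v _.
rewrite setIAC.
rewrite (_ : cylinder X B t `&` [set w | X u w = v] =
  cylinder X (fun s => [set y | B s y /\ (s = u -> y = v)]) t).
  (* The value v of X_u becomes a constraint at coordinate u; since u < t, the updated path still
     ends at [x t]. *)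
  rewrite (IHu (ltnW ut) _ (fun s => if s == u then v else x s)).
    by rewrite gtn_eqF.
  move=> s /andP[us st] y /= [By yv]; case: eqVneq => [/yv //|su].
  by apply: Bx By; rewrite st ltn_neqAle eq_sym su us.
apply/seteqP; split => w /= => [[hw hu] s st|hw].
  by split=> [|->//]; exact: hw.
by split=> [s /hw[]//|]; exact: (hw u (ltnW ut)).2.
Qed.

Lemma walk_taboo0 (j k : V) :
  fine (P (cylinder X (taboo j k 0) 0)) = (i == k)%:R.
Proof.
have E v : cylinder X (taboo j v 0) 0 = [set w | X 0%N w = v].
  apply/seteqP; split => w /= => [/(_ 0%N)|h [] //]; exact.
have mk v : measurable [set w | X 0%N w = v] by exact: (mX 0 [set v]).
rewrite E; have [<-|ik] := eqVneq; first by rewrite (walk_start hX).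
rewrite (_ : P _ = 0%E) //.
have PC0 : P (~` [set w | X 0%N w = i]) = 0%E.
  by rewrite probability_setC // (walk_start hX) subee.
apply: subset_measure0 PC0 => //; first exact: measurableC.
by move=> w /= -> /esym/eqP; rewrite (negPf ik).
Qed.

Lemma walk_tabooS (j k : V) (n : nat) :
  fine (P (cylinder X (taboo j k n.+1) n.+1)) =
  \sum_(l | l != j) fine (P (cylinder X (taboo j l n) n)) * A l k.
Proof.
rewrite (prob_partition (X n)) // [RHS]big_mkcond /=.
(* For l <> j, the condition X_n = l subsumes avoidance of j at time n; for l = j the event is
   empty, as time n is still taboo. *)
apply: eq_bigr => l _; case: ifPn => [lj|/negPn/eqP ->].
  rewrite -walk_cylinder_step; last by move=> y; rewrite /taboo /= ltnn.
  congr (fine (P _)); apply/seteqP; split => w /=.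
    case=> hw hl; split=> [s sn|].
      rewrite /taboo /=; case: ltnP => sn'.
        by have := hw s (leqW sn); rewrite /taboo /= ltnS sn.
      by rewrite (_ : s = n) //; apply/eqP; rewrite eqn_leq sn.
    by have := hw n.+1 (leqnn _); rewrite /taboo /= ltnn.
  case=> hw hk.
  have hl : X n w = l by have := hw n (leqnn n); rewrite /taboo /= ltnn.
  split=> // s; rewrite leq_eqVlt => /predU1P[->|]; rewrite /taboo /= ?ltnn //.
  rewrite ltnS => sn; rewrite sn.
  have := hw s sn; rewrite /taboo /=; by case: ltnP => // _ ->; apply/eqP.
rewrite (_ : _ `&` _ = set0) ?measure0 //.
apply/seteqP; split => // w /= [hw hj].
by have := hw n (leqnSn n); rewrite /taboo /= ltnSn; apply.
Qed.

End RandomWalk.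

Lemma big_delete {R : realType} {V : finType} {j : V} {m : nat}
    {f : 'I_m -> {v : V | v != j}} (hf : bijective f) (g : V -> R) :
  \sum_(l | l != j) g l = \sum_(b < m) g (sval (f b)).
Proof.
rewrite (big_sub (fun v => v != j)) (reindex f) //=.
exact: onW_bij.
Qed.

Lemma taboo_exp {R : realType} {V : finType} {A : V -> V -> R} {j : V}
    {m : nat} {f : 'I_m -> {v : V | v != j}} (hf : bijective f) {a : 'I_m}
    {d : measure_display} {T : measurableType d} {P : probability T R}
    {X : nat -> T -> V} (hX : random_walk_from A (sval (f a)) P X)
    (n : nat) (b : 'I_m) :
  fine (P (cylinder X (taboo j (sval (f b)) n) n)) =
  (deleted_matrix A f ^+ n) a b.
Proof.
elim: n b => [|n IHn] b.
  by rewrite (walk_taboo0 hX) expr0 mxE (inj_eq val_inj) (inj_eq (bij_inj hf)).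
(* The recursion appends the last step of the walk, so the new factor Q stands on the right. *)
rewrite (walk_tabooS hX) (big_delete hf) exprSr mxE.
by apply: eq_bigr => c _; rewrite IHn mxE.
Qed.

Theorem theorem1 (R : realType) (V : finType) (E : rel V) (A : V -> V -> R)
    (hA : transition_matrix_on E A) (j : V)
    (d : V -> measure_display) (T : forall i : V, measurableType (d i))
    (P : forall i : V, probability (T i) R) (X : forall i : V, nat -> T i -> V)
    (hX : forall i : V, random_walk_from A i (P i) (X i))
    (m : nat) (f : 'I_m -> {v : V | v != j}) (hf : bijective f)
    (n : nat) (hn : (1 <= n)%N) :
  hitting_vector P X f n =
  deleted_matrix A f ^+ (n - 1) *m hitting_vector P X f 1.
Proof.
(* The last step enters [j], hence the column A(., j) on the right; the case q = 0 identifies this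
   column with P_1. *)
have key q : hitting_vector P X f q.+1 =
    deleted_matrix A f ^+ q *m \col_a A (sval (f a)) j.
  apply/colP => a; rewrite !mxE /= hitting_time_taboo (walk_tabooS (hX _)).
  rewrite (big_delete hf); apply: eq_bigr => b _.
  by rewrite (taboo_exp hf (hX _)) !mxE.
by case: n hn => // n _; rewrite subn1 !key expr0 mul1mx.
Qed.
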